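(* For every Dirichlet polynomial $D(t)=\sum_{n} a_n n^{it}$ (a finite sum over positive integers $n$ with complex coefficients $a_n$) one has, as $T\to\infty$, $$\|D\|^2_{2,T}\ll T^2\int_1^{+\infty}\Big|\sum_n C_{y/T}(n-y)\,a_n\Big|^2\frac{dy}{y}+\int_1^{+\infty}\Big(\sum_{y-\Delta\le n\le y+\Delta}|a_n|\Big)^2\frac{dy}{y},$$ where $\Delta=\Delta(y,T)=y/T+O(y/T^2)$.
   Context: $\|D\|_{2,T}=\left(\int_{-T}^T|D(t)|^2dt\right)^{1/2}$. For $\delta>0$, the Cesàro weight is $C_\delta(y)=\max(1-\delta^{-1}|y|,0)$. The notation $A\ll B$ means $|A|\le cB$ for some constant $c>0$. *)

(* Defs.v *)
From HB Require Import structures.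
From mathcomp Require Import all_boot all_order all_algebra.
From mathcomp Require Import complex.
From mathcomp Require Import all_classical all_reals all_analysis.

Set Implicit Arguments.
Unset Strict Implicit.
Unset Printing Implicit Defensive.

Import Order.TTheory GRing.Theory Num.Theory.
Import numFieldNormedType.Exports.

Local Open Scope classical_set_scope.
Local Open Scope ring_scope.
Local Open Scope complex_scope.

(* The modulus as an element of R; the generic norm of R[i] takes values
   in R[i]. *)
Definition cabs (R : realType) (z : R[i]) : R := ComplexField.Normc.normc z.

(* n ^ (i t) = exp (i t ln n), for n >= 1. *)
Definition nat_cpow_it (R : realType) (n : nat) (t : R) : R[i] :=
  cos (t * ln n%:R) +i* sin (t * ln n%:R).

(* Only a 1, ..., a N matter; varying a and N gives every Dirichlet
   polynomial. *)
Definition dirichlet_poly (R : realType) (a : nat -> R[i]) (N : nat) (t : R) :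
    R[i] :=
  \sum_(1 <= n < N.+1) a n * nat_cpow_it n t.

Definition norm2T (R : realType) (D : R -> R[i]) (T : R) : \bar R :=
  ((\int[lebesgue_measure]_(t in `[(- T)%R, T]) (cabs (D t) ^+ 2)%:E)
     `^ (2^-1)%R)%E.

Definition cesaro_weight (R : realType) (delta y : R) : R :=
  Num.max (1 - delta^-1 * `|y|) 0.

Definition cesaro_sum (R : realType) (a : nat -> R[i]) (N : nat) (T y : R) :
    R[i] :=
  \sum_(1 <= n < N.+1) (cesaro_weight (y / T) (n%:R - y))%:C * a n.

Definition window_sum (R : realType) (a : nat -> R[i]) (N : nat) (Delta y : R) :
    R :=
  \sum_(1 <= n < N.+1 | y - Delta <= n%:R <= y + Delta) cabs (a n).

(* Main.v *)
(* Gallagher's argument. In the variable u = ln y put F(u) = sum_n a_n L(T (ln n - u)),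
   L being the tent function max(1 - |v|, 0). The Fourier transform of F at t is
   D(t) L^(t/T) / T, and L^ is bounded below on [-1, 1], so the mean square of D over
   [-T, T] is at most a constant times T^2 times that of F. This needs only the easy half of
   Plancherel: [-T, T] is cut into steps of length T/M, Bessel's inequality on a long
   interval [-X, X] with X = pi M / T bounds the sum of |F^|^2 over each translate of the
   grid, and averaging over the translates gives the integral. For large T the part u < 0
   sees only n = 1 and is dominated by its mirror image.
   Finally L(T ln (n/y)) and C_{y/T}(n - y) = L(T (n/y - 1)) differ by O(1/T), and both
   vanish unless |n - y| <= y/(T - 1), because x/(1+x) <= ln (1+x) <= x. *)
Require Import Defs.
From HB Require Import structures.
From mathcomp Require Import all_boot all_order all_algebra.
From mathcomp Require Import complex ring lra.
From mathcomp Require Import all_classical all_reals all_analysis.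
From mathcomp Require Import measurable_realfun.

Set Implicit Arguments.
Unset Strict Implicit.
Unset Printing Implicit Defensive.

Import Order.TTheory GRing.Theory Num.Theory.
Import numFieldNormedType.Exports.

Local Open Scope classical_set_scope.
Local Open Scope ring_scope.
Local Open Scope complex_scope.

(** * Integrals of continuous functions *)

Section Calculus.
Variable R : realType.
Implicit Types (f g P : R -> R) (a b x : R).

Lemma continuous_integrable_itv f a b : continuous f ->
  lebesgue_measure.-integrable `[a, b] (EFin \o f).
Proof.
move=> cf; apply: continuous_compact_integrable; first exact: segment_compact.
exact: continuous_subspaceT.
Qed.

Lemma is_derive_continuous f x (d : R) : is_derive x 1 f d -> {for x, continuous f}.
Proof. by move=> [df _]; apply/differentiable_continuous/derivable1_diffP. Qed.

Lemma FTC2_derive f P a b : a <= b -> continuous f ->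
  (forall x, a <= x <= b -> is_derive x 1 P (f x)) ->
  (\int[lebesgue_measure]_(x in `[a, b]) (f x)%:E = (P b - P a)%:E)%E.
Proof.
rewrite le_eqVlt => /predU1P[-> _ _|ab cf dP].
  by rewrite set_itv1 integral_set1 subrr.
rewrite EFinB; apply: continuous_FTC2 => //.
- exact: continuous_subspaceT.
- split.
  + move=> x; rewrite in_itv/= => /andP[ax xb].
    by have [] := dP x; rewrite ?(ltW ax) ?(ltW xb).
  + apply: cvg_at_right_filter; apply: (@is_derive_continuous _ _ (f a)).
    by apply: dP; rewrite lexx ltW.
  + apply: cvg_at_left_filter; apply: (@is_derive_continuous _ _ (f b)).
    by apply: dP; rewrite lexx ltW.
- move=> x; rewrite in_itv/= => /andP[ax xb].
  by rewrite derive1E; apply: (@derive_val _ _ _ _ _ _ _ (dP x _)); rewrite !ltW.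
Qed.

Lemma RFTC2 f P a b : a <= b -> continuous f ->
  (forall x, a <= x <= b -> is_derive x 1 P (f x)) ->
  \int[lebesgue_measure]_(x in `[a, b]) f x = P b - P a.
Proof. by move=> ab cf dP; rewrite /Rintegral (FTC2_derive ab cf dP). Qed.

(** The derivative is two-sided at every point right of [c]; callers place [c] one unit left of
    their interval so that its left endpoint is covered too. *)
Lemma primitive_exists f c : continuous f ->
  exists P, forall x, c < x -> is_derive x 1 P (f x).
Proof.
move=> cf; exists (fun y => \int[lebesgue_measure]_(t in `[c, y]) f t) => x cx.
have xx1 : x < x + 1 by rewrite ltrDl.
have [D DE] := continuous_FTC1_closed xx1 (continuous_integrable_itv c (x + 1) cf) cx (cf x).
by split; [exact: D|rewrite -derive1E DE].
Qed.

(** Both sides are the increment of one primitive of [f] between [phi a] and [phi b]. Hence [phi]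
    need not be monotone: it only has to stay right of [phi a], where the primitive is available. *)
Lemma Rintegral_substitution f (phi dphi : R -> R) a b : a <= b -> continuous f ->
  continuous (fun x => f (phi x) * dphi x) ->
  (forall x, a <= x <= b -> is_derive x 1 phi (dphi x)) ->
  (forall x, a <= x <= b -> phi a <= phi x) ->
  \int[lebesgue_measure]_(x in `[a, b]) (f (phi x) * dphi x) =
  \int[lebesgue_measure]_(x in `[phi a, phi b]) f x.
Proof.
move=> ab cf cfphi dphiP phia.
have [P dP] := primitive_exists (phi a - 1) cf.
have lt1 x : phi a <= x -> phi a - 1 < x.
  by move=> ax; rewrite ltrBlDr (le_lt_trans ax)// ltrDl.
transitivity ((P \o phi) b - (P \o phi) a).
  apply: RFTC2 => // x axb; apply: is_derive1_comp; first exact/dP/lt1/phia.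
  exact: dphiP.
rewrite [RHS](@RFTC2 _ P)//; first by rewrite phia// ab lexx.
by move=> x /andP[ax _]; apply/dP/lt1.
Qed.

Lemma Rintegral_cat f a b c : a <= b -> b <= c -> continuous f ->
  \int[lebesgue_measure]_(x in `[a, c]) f x =
  \int[lebesgue_measure]_(x in `[a, b]) f x + \int[lebesgue_measure]_(x in `[b, c]) f x.
Proof.
move=> ab bc cf; have [P dP] := primitive_exists (a - 1) cf.
have lt1 x : a <= x -> is_derive x 1 P (f x).
  by move=> ax; apply: dP; rewrite ltrBlDr (le_lt_trans ax)// ltrDl.
have E u v : a <= u -> u <= v -> \int[lebesgue_measure]_(x in `[u, v]) f x = P v - P u.
  move=> au uv; apply: RFTC2 => // x /andP[ux _]; exact/lt1/(le_trans au).
by rewrite !E// ?(le_trans ab bc)// [RHS]addrC addrA subrK.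
Qed.

Lemma Rintegral_sum (I : Type) (s : seq I) (F : I -> R -> R) a b :
  (forall i, continuous (F i)) ->
  \int[lebesgue_measure]_(x in `[a, b]) (\sum_(i <- s) F i x) =
  \sum_(i <- s) \int[lebesgue_measure]_(x in `[a, b]) F i x.
Proof.
move=> cF.
(* Additivity of the integral asks for integrability of the partial sums, so the induction carries
   it along. *)
suff H : lebesgue_measure.-integrable `[a, b] (EFin \o (fun x => \sum_(i <- s) F i x)) /\
  \int[lebesgue_measure]_(x in `[a, b]) (\sum_(i <- s) F i x) =
  \sum_(i <- s) \int[lebesgue_measure]_(x in `[a, b]) F i x by case: H.
elim: s => [|i s [IH1 IH2]].
  rewrite big_nil; split.
    rewrite (_ : EFin \o _ = EFin \o fun=> 0).
      by apply: continuous_integrable_itv => x; exact: cvg_cst.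
    by apply/funext => x /=; rewrite big_nil.
  under eq_Rintegral do rewrite big_nil.
  by rewrite Rintegral_cst//= mul0r.
have Fi := continuous_integrable_itv a b (cF i).
split.
  rewrite (_ : EFin \o _ = (EFin \o F i \+ (EFin \o (fun x => \sum_(j <- s) F j x)%R))%E).
    exact: integrableD.
  by apply/funext => x /=; rewrite big_cons EFinD.
under eq_Rintegral do rewrite big_cons.
by rewrite RintegralD// big_cons IH2.
Qed.

Lemma Rintegral_cst_itv (k : R) a b : a <= b ->
  \int[lebesgue_measure]_(x in `[a, b]) k = k * (b - a).
Proof.
move=> ab; rewrite mulrBr; apply: (@RFTC2 (fun=> k) (fun x => k * x)) => //.
- by move=> x; exact: cvg_cst.
- by move=> x _; apply: is_derive_eq; rewrite -[LHS]/(k * 1) mulr1.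
Qed.

End Calculus.

(* [continuous f] unfolds to a statement in which [f] occurs twice; a constant head lets
   [cts_tac] match on the shape of [f]. *)
Definition cts (R : realType) (f : R -> R) : Prop := continuous f.

(** * Closure properties of continuous functions *)

Section Cts.
Variable R : realType.
Implicit Types f g : R -> R.

Lemma cts_continuous f : cts f -> continuous f.
Proof. by []. Qed.

Lemma cts_add f g : cts f -> cts g -> cts (fun x => f x + g x).
Proof. by move=> cf cg x; apply: cvgD; [exact: cf|exact: cg]. Qed.

Lemma cts_mul f g : cts f -> cts g -> cts (fun x => f x * g x).
Proof. by move=> cf cg x; apply: cvgM; [exact: cf|exact: cg]. Qed.

Lemma cts_opp f : cts f -> cts (fun x => - f x).
Proof. by move=> cf x; apply: cvgN; exact: cf. Qed.

Lemma cts_sqr f : cts f -> cts (fun x => f x ^+ 2).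
Proof. exact: (fun cf => cts_mul cf cf). Qed.

Lemma cts_cst (k : R) : cts (fun _ : R => k).
Proof. by move=> x; exact: cvg_cst. Qed.

Lemma cts_id : cts (fun x : R => x).
Proof. by move=> x; exact: cvg_id. Qed.

Lemma cts_comp f g : cts f -> cts g -> cts (fun x => f (g x)).
Proof. by move=> cf cg x; apply: (@continuous_comp _ _ _ g f); [exact: cg|exact: cf]. Qed.

Lemma cts_cos f : cts f -> cts (fun x => cos (f x)).
Proof. by apply: cts_comp; exact: continuous_cos. Qed.

Lemma cts_sin f : cts f -> cts (fun x => sin (f x)).
Proof. by apply: cts_comp; exact: continuous_sin. Qed.

Lemma cts_sum (I : Type) (s : seq I) (G : I -> R -> R) :
  (forall i, cts (G i)) -> cts (fun x => \sum_(i <- s) G i x).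
Proof.
move=> cG; elim: s => [|i s IH].
  rewrite (_ : (fun _ => _) = fun=> 0); first exact: cts_cst.
  by apply/funext => x; rewrite big_nil.
rewrite (_ : (fun _ => _) = fun x => G i x + \sum_(j <- s) G j x).
  exact: cts_add.
by apply/funext => x; rewrite big_cons.
Qed.
End Cts.

Ltac cts_tac := lazymatch goal with
  | |- cts (fun _ => ?k) => exact (@cts_cst _ k)
  | |- cts (fun x => x) => exact (@cts_id _)
  | |- cts (fun x => GRing.add (@?f x) (@?g x)) => apply (@cts_add _ f g); cts_tac
  | |- cts (fun x => GRing.mul (@?f x) (@?g x)) => apply (@cts_mul _ f g); cts_tac
  | |- cts (fun x => GRing.opp (@?f x)) => apply (@cts_opp _ f); cts_tac
  | |- cts (fun x => GRing.exp (@?f x) 2) => apply (@cts_sqr _ f); cts_tac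
  | |- cts (fun x => cos (@?f x)) => apply (@cts_cos _ f); cts_tac
  | |- cts (fun x => sin (@?f x)) => apply (@cts_sin _ f); cts_tac
  | |- _ => first
    [ match goal with H : _ |- _ => solve [exact H | exact (H _) | exact (H _ _)] end
    | apply: cts_sum => ?; cbv beta; cts_tac ]
  end.
Ltac cont := apply: cts_continuous; cbv beta; cts_tac.

(** * Bessel's inequality *)

Section Bessel.
Variable R : realType.
Implicit Types (f g F : R -> R) (a b x : R).

(** Bessel for the exponentials exp (- i t_k u), orthogonal on [-X, X] with squared norm 2X, written
    in real form. It follows by expanding the nonnegative integral of |L F - (p - i q)|^2. *)
Lemma bessel_inequality (X : R) (m : nat) (t : nat -> R) F : 0 < X -> continuous F ->
  (forall i j, (i < m)%N -> (j < m)%N -> i != j ->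
    \int[lebesgue_measure]_(u in `[- X, X]) cos ((t i - t j) * u) = 0) ->
  (forall i j, (i < m)%N -> (j < m)%N ->
    \int[lebesgue_measure]_(u in `[- X, X]) sin ((t i - t j) * u) = 0) ->
  \sum_(i < m) ((\int[lebesgue_measure]_(u in `[- X, X]) (F u * cos (t i * u))) ^+ 2 +
                (\int[lebesgue_measure]_(u in `[- X, X]) (F u * sin (t i * u))) ^+ 2)
  <= 2 * X * \int[lebesgue_measure]_(u in `[- X, X]) (F u ^+ 2).
Proof.
move=> X0 cF co so.
pose al i := \int[lebesgue_measure]_(u in `[- X, X]) (F u * cos (t i * u)).
pose be i := \int[lebesgue_measure]_(u in `[- X, X]) (F u * sin (t i * u)).
pose L := 2 * X; pose S := \sum_(i < m) (al i ^+ 2 + be i ^+ 2).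
(* p - i q is L times the orthogonal projection of F onto the span of the exp (- i t_k u). *)
pose p u := \sum_(i < m) (al i * cos (t i * u) + be i * sin (t i * u)).
pose q u := \sum_(i < m) (al i * sin (t i * u) - be i * cos (t i * u)).
(* With c_k = [al k] + i [be k], this is the real part of c_i conj(c_j) exp (- i (t_i - t_j) u), the
   (i, j) term of |p - i q|^2. *)
pose E (i j : 'I_m) u := (al i * al j + be i * be j) * cos ((t i - t j) * u)
  + (be i * al j - al i * be j) * sin ((t i - t j) * u).
have cp : continuous p by rewrite /p; cont.
have cq : continuous q by rewrite /q; cont.
have cE i j : continuous (E i j) by rewrite /E; cont.
have pq u : p u ^+ 2 + q u ^+ 2 = \sum_i \sum_j E i j u.
  rewrite /p /q !expr2 !mulr_suml -big_split/=; apply: eq_bigr => i _.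
  rewrite !mulr_sumr -big_split/=; apply: eq_bigr => j _.
  by rewrite /E [(t i - t j) * u]mulrBl cosB sinB; ring.
have Ipq : \int[lebesgue_measure]_(u in `[- X, X]) (p u ^+ 2 + q u ^+ 2) = L * S.
  under eq_Rintegral do rewrite pq.
  rewrite Rintegral_sum; last by move=> i; cont.
  rewrite /S mulr_sumr; apply: eq_bigr => i _; rewrite Rintegral_sum//.
  have IE j : \int[lebesgue_measure]_(u in `[- X, X]) E i j u =
    (al i * al j + be i * be j) * \int[lebesgue_measure]_(u in `[- X, X]) cos ((t i - t j) * u).
    rewrite RintegralD//; first last.
    - by apply: continuous_integrable_itv; cont.
    - by apply: continuous_integrable_itv; cont.
    rewrite !RintegralZl//; first last.
    - by apply: continuous_integrable_itv; cont.
    - by apply: continuous_integrable_itv; cont.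
    by rewrite so// mulr0 addr0.
  rewrite (bigD1 i)//= big1 ?addr0.
    rewrite IE; under eq_Rintegral do rewrite subrr mul0r cos0.
    rewrite Rintegral_cst_itv; last by rewrite ge0_cp// ltW.
    by rewrite /L; ring.
  by move=> j ji; rewrite IE co ?mulr0// eq_sym.
have IFp : \int[lebesgue_measure]_(u in `[- X, X]) (F u * p u) = S.
  under eq_Rintegral do rewrite /p mulr_sumr.
  rewrite Rintegral_sum; last by move=> i; cont.
  apply: eq_bigr => i _.
  have -> : \int[lebesgue_measure]_(u in `[- X, X])
      (F u * (al i * cos (t i * u) + be i * sin (t i * u))) =
    \int[lebesgue_measure]_(u in `[- X, X])
      (al i * (F u * cos (t i * u)) + be i * (F u * sin (t i * u))).
    by apply: eq_Rintegral => u _; ring.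
  rewrite RintegralD//; first last.
  - by apply: continuous_integrable_itv; cont.
  - by apply: continuous_integrable_itv; cont.
  rewrite !RintegralZl//; first last.
  - by apply: continuous_integrable_itv; cont.
  - by apply: continuous_integrable_itv; cont.
(* The expansion is L^2 int F^2 - 2 L S + L S; dividing by L gives the claim. *)
have : 0 <= \int[lebesgue_measure]_(u in `[- X, X]) ((L * F u - p u) ^+ 2 + q u ^+ 2).
  by apply: Rintegral_ge0 => u _; rewrite addr_ge0 ?sqr_ge0.
have -> : \int[lebesgue_measure]_(u in `[- X, X]) ((L * F u - p u) ^+ 2 + q u ^+ 2) =
  \int[lebesgue_measure]_(u in `[- X, X])
    ((L ^+ 2 * F u ^+ 2 + (- 2 * L) * (F u * p u)) + (p u ^+ 2 + q u ^+ 2)).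
  by apply: eq_Rintegral => u _; ring.
rewrite RintegralD//; first last.
- by apply: continuous_integrable_itv; cont.
- by apply: continuous_integrable_itv; cont.
rewrite RintegralD//; first last.
- by apply: continuous_integrable_itv; cont.
- by apply: continuous_integrable_itv; cont.
rewrite !RintegralZl//; first last.
- by apply: continuous_integrable_itv; cont.
- by apply: continuous_integrable_itv; cont.
rewrite Ipq IFp => H.
have L0 : 0 < L by rewrite mulr_gt0.
rewrite -/L -/S -(ler_pM2l L0) -subr_ge0.
by apply: le_trans H _; rewrite le_eqVlt; apply/orP; left; apply/eqP; ring.
Qed.

End Bessel.

Definition tent (R : realType) (v : R) : R := Num.max (1 - `|v|) 0.

(** * The tent function *)

Section Tent.
Variable R : realType.
Implicit Types (f g h : R -> R) (a b x v w : R).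

Lemma tent_ge0 v : 0 <= tent v.
Proof. by rewrite /tent le_max lexx orbT. Qed.

Lemma tent_eq0 v : 1 <= `|v| -> tent v = 0.
Proof. by move=> v1; apply/max_idPr; rewrite subr_le0. Qed.

Lemma tentN v : tent (- v) = tent v.
Proof. by rewrite /tent normrN. Qed.

Lemma tent_ge v : 1 - `|v| <= tent v.
Proof. by rewrite /tent le_max lexx. Qed.

Lemma tent_lipschitz v w : `|tent v - tent w| <= `|v - w|.
Proof.
have := ler_dist_dist v w; set d := `|v - w|; rewrite /tent !ler_norml => /andP[d1 d2].
have d0 : 0 <= d by exact: normr_ge0.
by case: (leP (1 - `|v|) 0) => ?; case: (leP (1 - `|w|) 0) => ?; apply/andP; split; lra.
Qed.

Lemma cts_tent : cts (@tent R).
Proof.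
rewrite (_ : @tent R = fun v => 2^-1 * ((1 - `|v|) + `|1 - `|v| |)).
  have cn : cts (fun v : R => `|v|) by move=> v; exact: norm_continuous.
  apply: cts_mul; first exact: cts_cst.
  have c1 : cts (fun v : R => 1 - `|v|).
    by apply: cts_add; [exact: cts_cst|exact: cts_opp].
  by apply: cts_add => //; apply: (cts_comp cn).
by apply/funext => v; rewrite /tent maxr_absE subr0 addr0 mulrC.
Qed.

Lemma cts_tent_comp f : cts f -> cts (fun x => tent (f x)).
Proof. exact/cts_comp/cts_tent. Qed.

Lemma Rintegral_eq0 f a b : (forall x, a <= x <= b -> f x = 0) ->
  \int[lebesgue_measure]_(x in `[a, b]) f x = 0.
Proof.
move=> f0; rewrite (@eq_Rintegral _ _ _ _ _ (fun=> 0)).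
  by rewrite Rintegral_cst//= mul0r.
by move=> x; rewrite inE/= in_itv/=; exact: f0.
Qed.

Lemma Rintegral_truncate f a b : cts f -> a <= -1 -> 1 <= b ->
  (forall v, 1 <= `|v| -> f v = 0) ->
  \int[lebesgue_measure]_(x in `[a, b]) f x =
  \int[lebesgue_measure]_(x in `[-1, 1]) f x.
Proof.
move=> cf a1 b1 f0; have N11 : -1 <= 1 :> R by lra.
rewrite (Rintegral_cat a1 (le_trans N11 b1) cf) (Rintegral_cat N11 b1 cf).
rewrite [X in X + _]Rintegral_eq0 ?add0r; last first.
  by move=> x /andP[_ x1]; apply: f0; rewrite ler0_norm; lra.
rewrite [X in _ + X]Rintegral_eq0 ?addr0// => x /andP[x1 _].
by apply: f0; rewrite ger0_norm; lra.
Qed.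

Lemma Rintegral_opp f a b : a <= b -> cts f ->
  \int[lebesgue_measure]_(x in `[a, b]) f (- x) =
  \int[lebesgue_measure]_(x in `[- b, - a]) f x.
Proof.
move=> ab cf; rewrite /Rintegral (integration_by_substitution_oppr ab)//.
by apply: continuous_subspaceT; exact: cf.
Qed.

Lemma Rintegral_odd f X : 0 <= X -> cts f -> (forall x, f (- x) = - f x) ->
  \int[lebesgue_measure]_(x in `[- X, X]) f x = 0.
Proof.
move=> X0 cf fN; have XX : - X <= X by lra.
have := Rintegral_opp XX cf; rewrite opprK.
under eq_Rintegral do rewrite fN -mulN1r.
rewrite RintegralZl//; last exact: continuous_integrable_itv.
lra.
Qed.

(** The substitution v = T (u - lam), with the tent being even. The last two hypotheses say that the
    support [lam - 1/T, lam + 1/T] lies inside [-X, X]. *)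
Lemma tent_convolution h (T X lam : R) : 0 < T -> cts h ->
  1 <= T * (X - lam) -> 1 <= T * (X + lam) ->
  \int[lebesgue_measure]_(u in `[- X, X]) (tent (T * (lam - u)) * h u) =
  T^-1 * \int[lebesgue_measure]_(v in `[-1, 1]) (tent v * h (lam + T^-1 * v)).
Proof.
move=> T0 ch X1 X2; pose f v := T^-1 * (tent v * h (lam + T^-1 * v)).
have ch' : cts (fun v => h (lam + T^-1 * v)).
  by apply: (cts_comp ch); cts_tac.
have ct := cts_tent.
have cf0 : cts (fun v => tent v * h (lam + T^-1 * v)) by cts_tac.
have cf : cts f by rewrite /f; cts_tac.
rewrite -RintegralZl//; last exact: continuous_integrable_itv.
rewrite -(@Rintegral_truncate f (T * (- X - lam)) (T * (X - lam)))//; first last.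
- by move=> v v1; rewrite /f tent_eq0// mul0r mulr0.
- by move: X2; rewrite mulrDr mulrBr; lra.
have T0' : T != 0 by rewrite gt_eqF.
transitivity (\int[lebesgue_measure]_(u in `[- X, X]) (f (T * (u - lam)) * T)).
  apply: eq_Rintegral => u _; rewrite /f -(tentN (T * (u - lam))) -mulrN opprB.
  have -> : lam + T^-1 * (T * (u - lam)) = u by field.
  by field.
apply: (@Rintegral_substitution _ f (fun u => T * (u - lam)) (fun=> T)) => //.
- by nra.
- apply: cts_mul; last exact: cts_cst.
  by apply: (cts_comp cf); cts_tac.
- move=> u _; apply: is_derive_eq; rewrite /GRing.scale/=; lra.
- by move=> u /andP[Xu _]; rewrite ler_pM2l// lerD2r.
Qed.


Lemma cos1_le x : `|x| <= 1 -> cos 1 <= cos x :> R.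
Proof.
move=> x1; rewrite -(cos_norm x); have p2 := pi_ge2 R.
have p1 : 1 <= (pi : R) by lra.
have := @ltr_cos R 1 `|x|; rewrite !in_itv/= normr_ge0 ler01 p1 (le_trans x1 p1)/=.
by move=> /(_ isT isT) E; rewrite leNgt E -leNgt.
Qed.

(** The integrand is nonnegative throughout because |th v| <= 1. On the middle interval [-1/2, 1/2],
    of length 1, the tent is at least 1/2 and the cosine at least cos 1. *)
Lemma tent_cos_ge (th : R) : `|th| <= 1 ->
  cos 1 / 2 <= \int[lebesgue_measure]_(v in `[-1, 1]) (tent v * cos (th * v)).
Proof.
move=> th1; have c1 := cos1_gt0 R.
have cg : cts (fun v => tent v * cos (th * v)).
  by have ct := cts_tent; cts_tac.
have pos v : `|v| <= 1 -> 0 <= tent v * cos (th * v).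
  move=> v1; rewrite mulr_ge0 ?tent_ge0// (le_trans (ltW c1))// cos1_le//.
  by rewrite normrM mulr_ile1.
rewrite (@Rintegral_cat _ _ (-1) (- 2^-1) 1) ?(@Rintegral_cat _ _ (- 2^-1) 2^-1 1)//; try lra.
rewrite -[leLHS]add0r; apply: lerD.
  by apply: Rintegral_ge0 => v/=; rewrite in_itv/= => ?; apply: pos; rewrite ler_norml; lra.
rewrite -[leLHS]addr0; apply: lerD; last first.
  by apply: Rintegral_ge0 => v/=; rewrite in_itv/= => ?; apply: pos; rewrite ler_norml; lra.
have -> : cos 1 / 2 = \int[lebesgue_measure]_(v in `[(- 2^-1 : R), 2^-1]) (2^-1 * cos 1).
  by rewrite Rintegral_cst_itv; lra.
apply: le_Rintegral => //.
- by apply: continuous_integrable_itv; exact: cts_cst.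
- exact: continuous_integrable_itv.
- move=> v /=; rewrite in_itv/= -ler_norml => v2.
  rewrite ler_pM//; first exact: ltW.
    by apply: le_trans (tent_ge v); lra.
  apply: cos1_le; rewrite normrM mulr_ile1//; lra.
Qed.

End Tent.

(** * Mean squares *)

Section Energy.
Variable R : realType.
Implicit Types (f g h : R -> R) (a : nat -> R) (b c x v w T X t : R) (N : nat).

Lemma sin_natpi (k : nat) : sin (k%:R * pi) = 0 :> R.
Proof.
elim: k => [|k IH]; first by rewrite mul0r sin0.
by rewrite -natr1 mulrDl mul1r sinDpi IH oppr0.
Qed.

(** The primitive sin (tau u) / tau vanishes at both ends, since tau X is an integer multiple of pi.
    This is the orthogonality of frequencies spaced by pi / X. *)
Lemma Rintegral_cos_period (tau X : R) (i j : nat) : 0 < X -> i != j ->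
  tau * X = (i%:R - j%:R) * pi ->
  \int[lebesgue_measure]_(u in `[- X, X]) cos (tau * u) = 0.
Proof.
move=> X0 ij tX.
have tau0 : tau != 0.
  apply: contra ij => /eqP t0; move: tX; rewrite t0 mul0r => /esym/eqP.
  by rewrite mulf_eq0 (gt_eqF (pi_gt0 R)) orbF subr_eq0 eqr_nat.
transitivity (tau^-1 * sin (tau * X) - tau^-1 * sin (tau * - X)).
  apply: (@RFTC2 _ _ (fun u => tau^-1 * sin (tau * u))); first by lra.
    by have := @cts_id R => ?; cont.
  move=> u _.
  have H : is_derive u 1 (fun u : R => tau * u) tau.
    by apply: is_derive_eq; rewrite /GRing.scale/= mulr1.
  have H2 := @is_derive1_comp _ (@sin R) _ u _ _ (is_derive_sin (tau * u)) H.
  rewrite (_ : cos (tau * u) = tau^-1 *: (cos (tau * u) * tau)).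
    exact: is_deriveZ.
  by rewrite /GRing.scale/=; field.
by rewrite mulrN sinN tX mulrBl sinB !sin_natpi !(mul0r, mulr0) !subr0 oppr0 mulr0 subrr.
Qed.

Lemma Rintegral_sin_sym (tau X : R) : 0 <= X ->
  \int[lebesgue_measure]_(u in `[- X, X]) sin (tau * u) = 0.
Proof.
by move=> X0; apply: Rintegral_odd => // [|u]; [cts_tac|rewrite mulrN sinN].
Qed.

(** The 2M intervals of length T/M that make up [-T, T] are all translated onto the first one, where
    the sum of the translates of [f] is a sum over a shifted grid and so at most [B]. *)
Lemma Rintegral_sampling f T (M : nat) (B : R) : 0 < T -> (0 < M)%N -> continuous f ->
  (forall s, - T <= s <= - T + T / M%:R ->
    \sum_(k < M.*2) f (s + k%:R * (T / M%:R)) <= B) ->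
  \int[lebesgue_measure]_(t in `[- T, T]) f t <= T / M%:R * B.
Proof.
move=> T0 M0 cf fB; set d := T / M%:R.
have MR0 : 0 < M%:R :> R by rewrite ltr0n.
have d0 : 0 < d by rewrite divr_gt0.
have shift (k : nat) : \int[lebesgue_measure]_(t in `[- T, - T + d]) f (t + k%:R * d) =
    \int[lebesgue_measure]_(t in `[- T + k%:R * d, - T + k.+1%:R * d]) f t.
  transitivity (\int[lebesgue_measure]_(t in `[- T, - T + d]) (f (t + k%:R * d) * 1)).
    by apply: eq_Rintegral => t _; rewrite mulr1.
  rewrite (_ : - T + k.+1%:R * d = - T + d + k%:R * d); last by rewrite -natr1; ring.
  apply: (@Rintegral_substitution _ f (fun t => t + k%:R * d) (fun=> 1)) => //.
  - by rewrite lerDl ltW.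
  - apply: cts_mul; last exact: cts_cst.
    by apply: (cts_comp cf); cts_tac.
  - by move=> u _; apply: is_derive_eq; rewrite addr0.
  - by move=> u /andP[Xu _]; rewrite lerD2r.
have split (m : nat) : \int[lebesgue_measure]_(t in `[- T, - T + m%:R * d]) f t =
    \sum_(k < m) \int[lebesgue_measure]_(t in `[- T, - T + d]) f (t + k%:R * d).
  elim: m => [|m IH].
    by rewrite big_ord0 mul0r addr0 set_itv1 Rintegral_set1.
  rewrite big_ord_recr/= -IH shift; apply: Rintegral_cat => //.
    by rewrite lerDl mulr_ge0// ltW.
  by rewrite lerD2l ler_pM2r// ler_nat.
rewrite [X in `[- T, X]](_ : T = - T + M.*2%:R * d); last first.
  by rewrite /d -muln2 natrM; field; rewrite gt_eqF.
rewrite split -Rintegral_sum; last first.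
  by move=> k; apply: (cts_comp cf); cts_tac.
have -> : d * B = \int[lebesgue_measure]_(t in `[- T, - T + d]) B.
  by rewrite Rintegral_cst_itv; [ring|rewrite lerDl ltW].
apply: le_Rintegral => //.
- apply: continuous_integrable_itv; apply: cts_sum => k.
  by apply: (cts_comp cf); cts_tac.
- by apply: continuous_integrable_itv; exact: cts_cst.
Qed.

(** The function F of Gallagher's argument, for real coefficients; complex ones are later split into
    real and imaginary parts. *)
Definition tent_sum a N T (u : R) : R :=
  \sum_(1 <= n < N.+1) a n * tent (T * (ln n%:R - u)).

(** For real coefficients, this and [sin_sum] are the real and imaginary parts of the Dirichlet
    polynomial. *)
Definition cos_sum a N (t : R) : R := \sum_(1 <= n < N.+1) a n * cos (t * ln n%:R).
Definition sin_sum a N (t : R) : R := \sum_(1 <= n < N.+1) a n * sin (t * ln n%:R).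

Lemma cts_tent_sum a N T : cts (tent_sum a N T).
Proof.
rewrite /tent_sum; apply: cts_sum => n; apply: cts_mul; first exact: cts_cst.
by apply: cts_tent_comp; cts_tac.
Qed.

(** The Fourier transform of the tent; by evenness the sine part vanishes. *)
Definition tent_hat (th : R) : R :=
  \int[lebesgue_measure]_(v in `[-1, 1]) (tent v * cos (th * v)).

Lemma Rintegral_tent_sin (th : R) :
  \int[lebesgue_measure]_(v in `[-1, 1]) (tent v * sin (th * v)) = 0.
Proof.
have ct := @cts_tent R.
by apply: Rintegral_odd => // [|v]; [cts_tac|rewrite tentN mulrN sinN mulrN].
Qed.

Lemma Rintegral_tent_cos_shift (al th : R) :
  \int[lebesgue_measure]_(v in `[-1, 1]) (tent v * cos (al + th * v)) = cos al * tent_hat th.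
Proof.
have ct := @cts_tent R.
transitivity (\int[lebesgue_measure]_(v in `[-1, 1])
  (cos al * (tent v * cos (th * v)) + (- sin al) * (tent v * sin (th * v)))).
  by apply: eq_Rintegral => v _; rewrite cosD; ring.
rewrite RintegralD//; first last.
- by apply: continuous_integrable_itv; cont.
- by apply: continuous_integrable_itv; cont.
rewrite !RintegralZl//; first last.
- by apply: continuous_integrable_itv; cont.
- by apply: continuous_integrable_itv; cont.
by rewrite Rintegral_tent_sin mulr0 addr0.
Qed.

Lemma Rintegral_tent_sin_shift (al th : R) :
  \int[lebesgue_measure]_(v in `[-1, 1]) (tent v * sin (al + th * v)) = sin al * tent_hat th.
Proof.
rewrite -cosBpihalf -Rintegral_tent_cos_shift; apply: eq_Rintegral => v _.
by rewrite -cosBpihalf addrAC.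
Qed.

(** * Fourier coefficients of the tent sum on [-X, X] *)

Section Fourier.
Variables (a : nat -> R) (N : nat) (T X : R).
Hypotheses (T0 : 0 < T) (XN : forall n, (0 < n <= N)%N -> 1 <= T * (X - ln n%:R)) (X1 : 1 <= T * X).

(** Termwise [tent_convolution]: [XN] keeps the right end ln n + 1/T of each support inside [-X, X],
    and [X1] with ln n >= 0 keeps the left end inside. *)
Lemma Rintegral_tent_sum_mul h : cts h ->
  \int[lebesgue_measure]_(u in `[- X, X]) (tent_sum a N T u * h u) =
  T^-1 * \sum_(1 <= n < N.+1)
     a n * \int[lebesgue_measure]_(v in `[-1, 1]) (tent v * h (ln n%:R + T^-1 * v)).
Proof.
move=> ch; have ct := @cts_tent R.
have cth n : cts (fun u => tent (T * (ln n%:R - u)) * h u).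
  by apply: cts_mul => //; apply: cts_tent_comp; cts_tac.
transitivity (\int[lebesgue_measure]_(u in `[- X, X])
  (\sum_(1 <= n < N.+1) a n * (tent (T * (ln n%:R - u)) * h u))).
  by apply: eq_Rintegral => u _; rewrite /tent_sum mulr_suml; apply: eq_bigr => n _; rewrite mulrA.
rewrite Rintegral_sum; last by move=> n; apply: cts_mul => //; exact: cts_cst.
rewrite mulr_sumr; apply: eq_big_nat => n nN.
rewrite RintegralZl//; last exact: (continuous_integrable_itv _ _ (cth n)).
rewrite tent_convolution//; first by rewrite mulrCA.
  by apply: XN.
have /andP[n1 _] := nN.
apply: le_trans X1 _; rewrite ler_pM2l// lerDl ln_ge0// ler1n//.
Qed.

(** Centring a tent at ln n contributes the phase t ln n, and shrinking it by T turns its transform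
    into [tent_hat (t / T)] divided by T. *)
Lemma tent_sum_fourier_cos (t : R) :
  \int[lebesgue_measure]_(u in `[- X, X]) (tent_sum a N T u * cos (t * u)) =
  T^-1 * tent_hat (t / T) * cos_sum a N t.
Proof.
rewrite (@Rintegral_tent_sum_mul (fun u => cos (t * u))); last by cts_tac.
rewrite -mulrA; congr (_ * _); rewrite /cos_sum mulr_sumr; apply: eq_bigr => n _.
under eq_Rintegral do rewrite mulrDr mulrA.
by rewrite Rintegral_tent_cos_shift [RHS]mulrC mulrA.
Qed.

Lemma tent_sum_fourier_sin (t : R) :
  \int[lebesgue_measure]_(u in `[- X, X]) (tent_sum a N T u * sin (t * u)) =
  T^-1 * tent_hat (t / T) * sin_sum a N t.
Proof.
rewrite (@Rintegral_tent_sum_mul (fun u => sin (t * u))); last by cts_tac.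
rewrite -mulrA; congr (_ * _); rewrite /sin_sum mulr_sumr; apply: eq_bigr => n _.
under eq_Rintegral do rewrite mulrDr mulrA.
by rewrite Rintegral_tent_sin_shift [RHS]mulrC mulrA.
Qed.
End Fourier.

(** The squared modulus of the Dirichlet polynomial with real coefficients [a]. *)
Definition energy a N t := cos_sum a N t ^+ 2 + sin_sum a N t ^+ 2.

Lemma cts_energy a N : cts (energy a N).
Proof.
have c1 : cts (cos_sum a N) by rewrite /cos_sum; apply: cts_sum => n; cts_tac.
have c2 : cts (sin_sum a N) by rewrite /sin_sum; apply: cts_sum => n; cts_tac.
by rewrite /energy; cts_tac.
Qed.

(** With X = pi M / T the grid step T/M equals pi / X, so the sampled exponentials are orthogonal on
    [-X, X] and Bessel bounds every grid sum. *)
Lemma energy_le_tent_sum a N T (M : nat) : 0 < T -> (0 < M)%N ->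
  (forall n, (0 < n <= N)%N -> 1 <= T * (pi * M%:R / T - ln n%:R)) ->
  \int[lebesgue_measure]_(t in `[- T, T]) energy a N t <=
  2 * pi * (cos 1 / 2) ^- 2 * T ^+ 2 *
    \int[lebesgue_measure]_(u in `[- (pi * M%:R / T), pi * M%:R / T]) tent_sum a N T u ^+ 2.
Proof.
move=> T0 M0; set X := pi * M%:R / T => XN.
have MR0 : 0 < M%:R :> R by rewrite ltr0n.
have pi0 := pi_gt0 R.
have X0 : 0 < X by rewrite divr_gt0// mulr_gt0.
have X1 : 1 <= T * X.
  rewrite /X mulrCA mulfV ?gt_eqF// mulr1.
  have p2 := pi_ge2 R; have : 1 <= M%:R :> R by rewrite ler1n.
  nra.
set k0 := cos 1 / 2; have k00 : 0 < k0 by rewrite divr_gt0// cos1_gt0.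
set I := \int[lebesgue_measure]_(u in `[- X, X]) _.
have I0 : 0 <= I by apply: Rintegral_ge0 => u _; exact: sqr_ge0.
(* The M in the step length T/M cancels the one in 2X, so the constant does not depend on M. *)
rewrite (_ : _ * I = T / M%:R * (k0 ^- 2 * T ^+ 2 * (2 * X * I))); last first.
  by rewrite /X; field; rewrite !gt_eqF.
apply: Rintegral_sampling => //; first exact: cts_energy.
move=> s sT; pose t k := s + k%:R * (T / M%:R).
have tX i j : (t i - t j) * X = (i%:R - j%:R) * pi.
  by rewrite /t /X; field; rewrite !gt_eqF.
have := @bessel_inequality _ X M.*2 t (tent_sum a N T) X0 (@cts_tent_sum a N T)
  (fun i j _ _ ij => Rintegral_cos_period X0 ij (tX i j))
  (fun i j _ _ => Rintegral_sin_sym (t i - t j) (ltW X0)).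
under eq_bigr do rewrite tent_sum_fourier_cos// tent_sum_fourier_sin//.
rewrite -/I => H.
set S := leLHS.
have -> : S = k0 ^- 2 * T ^+ 2 * (k0 ^+ 2 * T ^- 2 * S).
  by field; rewrite !gt_eqF.
rewrite ler_pM2l; last by rewrite mulr_gt0 ?invr_gt0 ?exprn_gt0.
apply: le_trans H; rewrite mulr_sumr; apply: ler_sum => k _.
have tT : `|t k / T| <= 1.
  rewrite normrM normfV (gtr0_norm T0) ler_pdivrMr// mul1r ler_norml /t.
  move: sT => /andP[s1 s2].
  (* The starting point s may exceed -T by a whole step, so t_k <= -T + (k + 1) T/M; k + 1 <= 2M
     keeps it at most T. *)
  have kM : k.+1%:R <= M.*2%:R :> R by rewrite ler_nat.
  have d0 : 0 < T / M%:R by rewrite divr_gt0.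
  have k0' : 0 <= k%:R :> R by [].
  have E : M.*2%:R * (T / M%:R) = 2 * T :> R.
    by rewrite -muln2 natrM; field; rewrite gt_eqF.
  have : k.+1%:R * (T / M%:R) <= 2 * T by rewrite -E ler_pM2r.
  rewrite -natr1 mulrDl mul1r => ?.
  have : 0 <= k%:R * (T / M%:R) by rewrite mulr_ge0// ltW.
  by move=> ?; apply/andP; split; lra.
have K := tent_cos_ge tT; rewrite -/k0 -/(tent_hat _) in K.
rewrite /energy -/(t k) mulrDr; set c := cos_sum _ _ _; set d := sin_sum _ _ _.
have K2 : k0 ^+ 2 <= tent_hat (t k / T) ^+ 2 by rewrite ler_sqr ?nnegrE// ltW// (lt_le_trans k00).
have K3 : k0 ^+ 2 * T ^- 2 <= (T^-1 * tent_hat (t k / T)) ^+ 2.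
  by rewrite [leRHS]exprMn exprVn [leLHS]mulrC ler_wpM2l// invr_ge0 exprn_ge0// ltW.
by apply: lerD; rewrite (exprMn _ (T^-1 * _)) ler_wpM2r// sqr_ge0.
Qed.

End Energy.

(** * Logarithmic and linear windows *)

Section Edge.
Variable R : realType.
Implicit Types (f g h : R -> R) (a : nat -> R) (b c x u v w T X t y : R) (N n : nat).

(** The inequality ln (1 + x) <= x at x = -1/2. *)
Lemma ln2_ge : 2^-1 <= ln 2 :> R.
Proof.
have := @le_ln1Dx R (- 2^-1); rewrite (_ : 1 + - 2^-1 = 2^-1); last by field.
have two0 : (2 : R) \in Num.pos by rewrite posrE.
rewrite lnV//; lra.
Qed.

Lemma tent_sum_head a N T u :
  (forall n, (1 < n)%N -> 1 <= `|T * (ln n%:R - u)|) ->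
  tent_sum a N T u = if N == 0%N then 0 else a 1%N * tent (T * u).
Proof.
move=> far; rewrite /tent_sum; case: N => [|N]; first by rewrite big_geq.
rewrite big_ltn// ln1 sub0r mulrN tentN big_nat big1 ?addr0//.
by move=> n /andP[n1 _]; rewrite tent_eq0 ?mulr0//; exact: far.
Qed.

(** With T >= 4 and u < 1/T this gives T (ln n - u) >= 1, so the tents of all n > 1 vanish at u. *)
Lemma ln_ge_half n : (1 < n)%N -> 2^-1 <= ln n%:R :> R.
Proof.
move=> n1; apply: le_trans ln2_ge _; rewrite ler_ln ?posrE ?ltr0n ?ler_nat//.
exact: ltnW.
Qed.

(* For u >= 0 only n = 1 contributes to the left-hand side, and the right-hand side has no
   other term as long as u <= 1/T. *)
Lemma tent_sum_reflect a N T u : 4 <= T -> 0 <= u ->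
  tent_sum a N T (- u) ^+ 2 <= tent_sum a N T u ^+ 2.
Proof.
move=> T4 u0; rewrite tent_sum_head; last first.
  move=> n /ln_ge_half n2; rewrite ger0_norm; nra.
case: eqVneq => [_|N0]; first by rewrite expr0n/= sqr_ge0.
have [Tu|Tu] := leP 1 (T * u).
  by rewrite mulrN tentN tent_eq0 ?mulr0 ?expr0n ?sqr_ge0// ger0_norm; lra.
rewrite tent_sum_head; last first.
  move=> n /ln_ge_half n2; rewrite ger0_norm; nra.
by rewrite (negPf N0) mulrN tentN.
Qed.

Lemma tent_sum_half a N T X : 4 <= T -> 0 <= X ->
  \int[lebesgue_measure]_(u in `[- X, X]) tent_sum a N T u ^+ 2 <=
  2 * \int[lebesgue_measure]_(u in `[0, X]) tent_sum a N T u ^+ 2.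
Proof.
move=> T4 X0; have ct := @cts_tent_sum R a N T.
have c2 : cts (fun u => tent_sum a N T u ^+ 2) by cts_tac.
have c3 : cts (fun u => tent_sum a N T (- u) ^+ 2).
  exact: (cts_comp c2 (cts_opp (@cts_id R))).
have NX0 : - X <= 0 by lra.
rewrite (Rintegral_cat NX0 X0)// mulr_natl mulr2n lerD2r.
have := Rintegral_opp X0 c2; rewrite oppr0 => <-.
apply: le_Rintegral => //; try exact: continuous_integrable_itv.
by move=> u /=; rewrite in_itv/= => /andP[u0 _]; exact: tent_sum_reflect.
Qed.

Lemma cts_max1 : cts (fun y : R => Num.max y 1).
Proof.
rewrite (_ : (fun _ => _) = fun y : R => 2^-1 * ((y + 1) + `|y - 1|)).
  have cn : cts (fun v : R => `|v|) by move=> v; exact: norm_continuous.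
  apply: cts_mul; first exact: cts_cst.
  by apply: cts_add; [cts_tac|apply: (cts_comp cn); cts_tac].
by apply/funext => v; rewrite maxr_absE mulrC.
Qed.

(* [Num.max y 1] equals y on the range of integration; it makes the integrand continuous on
   the whole line. *)
Lemma Rintegral_expR f X : 0 <= X -> cts f ->
  \int[lebesgue_measure]_(u in `[0, X]) f u =
  \int[lebesgue_measure]_(y in `[1, expR X]) (f (ln (Num.max y 1)) / Num.max y 1) /\
  lebesgue_measure.-integrable `[1, expR X]
    (EFin \o (fun y => f (ln (Num.max y 1)) / Num.max y 1)).
Proof.
move=> X0 cf; pose g y := f (ln (Num.max y 1)) / Num.max y 1.
have m0 y : 0 < Num.max y 1 by rewrite lt_max ltr01 orbT.
have cg : cts g.
  apply: cts_mul.
    apply: (cts_comp cf) => y.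
    by apply: continuous_comp; [exact: cts_max1|exact: continuous_ln].
  move=> y; apply: (@continuous_comp _ _ _ (fun y : R => Num.max y 1) (@GRing.inv R)).
    exact: cts_max1.
  by apply: inv_continuous; rewrite gt_eqF.
split; last exact: continuous_integrable_itv.
transitivity (\int[lebesgue_measure]_(y in `[expR 0, expR X]) g y); last by rewrite expR0.
transitivity (\int[lebesgue_measure]_(u in `[0, X]) (g (expR u) * expR u)).
  apply: eq_Rintegral => u; rewrite inE/= in_itv/= => /andP[u0 _].
  rewrite /g max_l ?expRK ?mulfVK ?gt_eqF ?expR_gt0//.
  by rewrite -expR0 ler_expR.
have ce : cts (@expR R) := @continuous_expR R.
apply: (@Rintegral_substitution _ g expR expR) => //.
  by apply: cts_mul => //; apply: (cts_comp cg).
by move=> u /andP[u0 _]; rewrite ler_expR.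
Qed.

(** With x = n/y - 1 the two weights are the tent at T ln (1 + x) and at T x. Inside the window |x|
    <= 2/T and |ln (1 + x) - x| <= 2 x^2, so the Lipschitz bound gives T * 2 * 4/T^2 = 8/T; outside
    both weights vanish. *)
Lemma tent_cesaro T y n : 4 <= T -> 1 <= y -> (0 < n)%N ->
  `|tent (T * (ln n%:R - ln y)) - cesaro_weight (y / T) (n%:R - y)| <=
  if y - y / (T - 1) <= n%:R <= y + y / (T - 1) then 8 / T else 0.
Proof.
move=> T4 y1 n0; have T0 : 0 < T by lra.
have y0 : 0 < y by lra.
have n0' : 0 < n%:R :> R by rewrite ltr0n.
set x := n%:R / y - 1.
have xE : n%:R = y * (1 + x) by rewrite /x; field; rewrite gt_eqF.
have x1 : 0 < 1 + x by rewrite /x addrC subrK divr_gt0.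
have -> : cesaro_weight (y / T) (n%:R - y) = tent (T * x).
  rewrite /cesaro_weight /tent xE (_ : y * (1 + x) - y = y * x); last by ring.
  by congr (Num.max (1 - _) 0); rewrite !normrM (gtr0_norm y0) (gtr0_norm T0); field; rewrite !gt_eqF.
have -> : ln n%:R - ln y = ln (1 + x).
  by rewrite xE lnM ?posrE// addrC addKr.
have up : ln (1 + x) <= x by apply: le_ln1Dx; lra.
(* Apply ln (1 + w) <= w to w = - x/(1 + x), for which 1 + w = 1/(1 + x). *)
have lo : x / (1 + x) <= ln (1 + x).
  have : ln (1 + (- (x / (1 + x)))) <= - (x / (1 + x)).
    apply: le_ln1Dx; rewrite ltrN2 ltr_pdivrMr//; lra.
  rewrite (_ : 1 + - (x / (1 + x)) = (1 + x)^-1); last by field; rewrite gt_eqF.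
  by rewrite lnV ?posrE//; lra.
have eqw : (y - y / (T - 1) <= n%:R <= y + y / (T - 1)) = (`|x| <= (T - 1)^-1).
  rewrite ler_norml xE (_ : y - y / (T - 1) = y * (1 - (T - 1)^-1)); last by ring.
  rewrite (_ : y + y / (T - 1) = y * (1 + (T - 1)^-1)); last by ring.
  by rewrite !ler_pM2l// lerD2l lerD2l.
rewrite eqw; have T1 : 0 < T - 1 by lra.
case: ifPn => [xs|].
  apply: le_trans (tent_lipschitz _ _) _.
  rewrite -mulrBr normrM (gtr0_norm T0).
  have xs2 : `|x| <= 2 / T.
    apply: le_trans xs _; rewrite ler_pdivlMr// mulrC ler_pdivrMr//; lra.
  have xs3 : `|x| <= 2^-1.
    by apply: le_trans xs2 _; rewrite ler_pdivrMr//; lra.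
  move: (xs3); rewrite ler_norml => /andP[xl xr].
  have b : `|ln (1 + x) - x| <= 2 * x ^+ 2.
    rewrite ler0_norm; last by lra.
    have E : x / (1 + x) = x - x ^+ 2 / (1 + x) by field; rewrite gt_eqF.
    have : x ^+ 2 / (1 + x) <= 2 * x ^+ 2.
      by rewrite ler_pdivrMr//; have := sqr_ge0 x; nra.
    lra.
  have wT : `|x| * T <= 2 by rewrite -ler_pdivlMr.
  have wT2 : (`|x| * T) ^+ 2 <= 4.
    have : 0 <= `|x| * T by rewrite mulr_ge0// ltW.
    by move: (`|x| * T) wT => w; nra.
  rewrite ler_pdivlMr//; apply: (@le_trans _ _ (T ^+ 2 * (2 * x ^+ 2))).
    by rewrite mulrAC -expr2 ler_wpM2l// sqr_ge0.
  rewrite -[x ^+ 2]real_normK ?num_real//; move: wT2; rewrite exprMn => wT2.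
  by rewrite mulrCA [X in 2 * X]mulrC; lra.
rewrite -ltNge => xb.
have xb1 : 1 <= T * `|x|.
  have : (T - 1) * `|x| > 1 by rewrite mulrC -ltr_pdivrMr// div1r.
  have := normr_ge0 x; nra.
rewrite [tent (T * x)]tent_eq0 ?subr0; last by rewrite normrM (gtr0_norm T0).
rewrite tent_eq0 ?normr0// normrM (gtr0_norm T0).
(* For x >= 0, T x/(1 + x) >= 1 amounts to (T - 1) x >= 1, which dictates the radius y/(T - 1). For
   x < 0, ln (1 + x) <= x already suffices. *)
have [x0|x0] := leP 0 x.
  rewrite ger0_norm in xb; last by [].
  rewrite ger0_norm; last by apply: le_trans lo; rewrite divr_ge0// ltW.
  apply: le_trans (ler_wpM2l (ltW T0) lo).
  rewrite mulrA ler_pdivlMr//.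
  have : (T - 1) * x > 1 by rewrite mulrC -ltr_pdivrMr// div1r.
  lra.
rewrite (ltr0_norm x0) in xb1; rewrite ler0_norm; last lra.
by apply: le_trans xb1 _; rewrite ler_pM2l//; lra.
Qed.

End Edge.

(** * Complex coefficients *)

Section Comparison.
Variable R : realType.
Implicit Types (a : nat -> R[i]) (b : nat -> R) (c x u v w T X t y : R) (N n : nat) (z : R[i]).

Lemma cabs_sqr z : cabs z ^+ 2 = complex.Re z ^+ 2 + complex.Im z ^+ 2.
Proof. by case: z => x y; rewrite /cabs/= sqr_sqrtr// addr_ge0 ?sqr_ge0. Qed.

Lemma cabs_ge0 z : 0 <= cabs z.
Proof. by case: z => x y; rewrite /cabs/= sqrtr_ge0. Qed.

Lemma normRe_le_cabs z : `|complex.Re z| <= cabs z.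
Proof.
case: z => x y; rewrite /cabs/= -sqrtr_sqr ler_sqrt ?lerDl ?sqr_ge0//.
by rewrite addr_ge0 ?sqr_ge0.
Qed.

Lemma normIm_le_cabs z : `|complex.Im z| <= cabs z.
Proof.
case: z => x y; rewrite /cabs/= -sqrtr_sqr ler_sqrt ?lerDr ?sqr_ge0//.
by rewrite addr_ge0 ?sqr_ge0.
Qed.

Lemma Re_sum (I : Type) (s : seq I) (P : pred I) (F : I -> R[i]) :
  complex.Re (\sum_(i <- s | P i) F i) = \sum_(i <- s | P i) complex.Re (F i).
Proof. by apply: (big_morph (@complex.Re R)) => // -[? ?] [? ?]. Qed.

Lemma Im_sum (I : Type) (s : seq I) (P : pred I) (F : I -> R[i]) :
  complex.Im (\sum_(i <- s | P i) F i) = \sum_(i <- s | P i) complex.Im (F i).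
Proof. by apply: (big_morph (@complex.Im R)) => // -[? ?] [? ?]. Qed.

Definition weighted_sum b N T y : R :=
  \sum_(1 <= n < N.+1) cesaro_weight (y / T) (n%:R - y) * b n.

Lemma cabs_cesaro_sum a N T y : cabs (cesaro_sum a N T y) ^+ 2 =
  weighted_sum (@complex.Re R \o a) N T y ^+ 2 + weighted_sum (@complex.Im R \o a) N T y ^+ 2.
Proof.
rewrite cabs_sqr Re_sum Im_sum; congr (_ ^+ 2 + _ ^+ 2); apply: eq_bigr => n _ /=;
by case: (a n) => x v /=; rewrite !mul0r ?subr0 ?addr0.
Qed.

Lemma cabs_dirichlet_poly a N t : cabs (dirichlet_poly a N t) ^+ 2 =
  (cos_sum (@complex.Re R \o a) N t - sin_sum (@complex.Im R \o a) N t) ^+ 2 +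
  (sin_sum (@complex.Re R \o a) N t + cos_sum (@complex.Im R \o a) N t) ^+ 2.
Proof.
rewrite cabs_sqr Re_sum Im_sum /cos_sum /sin_sum -sumrB -big_split/=.
by congr (_ ^+ 2 + _ ^+ 2); apply: eq_bigr => n _ /=; case: (a n).
Qed.

(** D is D_re + i D_im, the polynomials with coefficients Re a_n and Im a_n, and |z + w|^2 <= 2
    (|z|^2 + |w|^2). *)
Lemma cabs_dirichlet_poly_le a N t : cabs (dirichlet_poly a N t) ^+ 2 <=
  2 * (energy (@complex.Re R \o a) N t + energy (@complex.Im R \o a) N t).
Proof.
rewrite cabs_dirichlet_poly /energy; set p := cos_sum _ _ _; set q := sin_sum _ _ _.
set r := sin_sum _ _ _; set s := cos_sum _ _ _.
have := sqr_ge0 (p + q); have := sqr_ge0 (r - s).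
by rewrite !sqrrD !sqrrN; lra.
Qed.

Lemma cts_cabs_dirichlet_poly a N : cts (fun t => cabs (dirichlet_poly a N t) ^+ 2).
Proof.
rewrite (_ : (fun _ => _) = fun t =>
  (cos_sum (@complex.Re R \o a) N t - sin_sum (@complex.Im R \o a) N t) ^+ 2 +
  (sin_sum (@complex.Re R \o a) N t + cos_sum (@complex.Im R \o a) N t) ^+ 2).
  have cc b : cts (cos_sum b N) by rewrite /cos_sum; apply: cts_sum => n; cts_tac.
  have cs b : cts (sin_sum b N) by rewrite /sin_sum; apply: cts_sum => n; cts_tac.
  by cts_tac.
by apply/funext => t; exact: cabs_dirichlet_poly.
Qed.

(** Summing [tent_cesaro] gives |A - B| <= (8/T) W, and A^2 <= 2 B^2 + 2 (A - B)^2 yields the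
    constant 128 = 2 * 8^2. Here [b] stands for the real or the imaginary part of [a]. *)
Lemma tent_sum_le a b N T y : 4 <= T -> 1 <= y -> (forall n, `|b n| <= cabs (a n)) ->
  tent_sum b N T (ln y) ^+ 2 <=
  2 * weighted_sum b N T y ^+ 2 + 128 / T ^+ 2 * window_sum a N (y / (T - 1)) y ^+ 2.
Proof.
move=> T4 y1 ba; have T0 : 0 < T by lra.
set A := tent_sum _ _ _ _; set B := weighted_sum _ _ _ _; set W := window_sum _ _ _ _.
have W0 : 0 <= W by apply: sumr_ge0 => n _; exact: cabs_ge0.
have AB : `|A - B| <= 8 / T * W.
  rewrite /A /B /W /tent_sum /weighted_sum /window_sum -sumrB.
  apply: le_trans (ler_norm_sum _ _ _) _.
  rewrite mulr_sumr [leRHS]big_mkcond/=; apply: ler_sum_nat => n /andP[n0 _].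
  rewrite [_ * b n]mulrC -mulrBr normrM.
  apply: le_trans (ler_wpM2l (normr_ge0 _) (tent_cesaro T4 y1 n0)) _.
  case: ifP => _; last by rewrite mulr0.
  by rewrite mulrC ler_wpM2l// ltW// divr_gt0.
have T8 : 0 <= 8 / T by rewrite divr_ge0// ltW.
have AB2 : (A - B) ^+ 2 <= 64 / T ^+ 2 * W ^+ 2.
  rewrite -[leLHS]real_normK ?num_real// (_ : _ * W ^+ 2 = (8 / T * W) ^+ 2).
    by rewrite ler_sqr ?nnegrE// mulr_ge0.
  by field; rewrite gt_eqF.
(* (A - 2B)^2 >= 0 is a rearrangement of A^2 <= 2 B^2 + 2 (A - B)^2. *)
have := sqr_ge0 (A - 2 * B).
rewrite (_ : 128 / T ^+ 2 * W ^+ 2 = 2 * (64 / T ^+ 2 * W ^+ 2)); last by ring.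
by move: AB2; rewrite !sqrrB; lra.
Qed.

(** The factor T^2 cancels the 1/T^2 of the squared error, which is why the window term carries no
    power of T; 256 is 128 for each of the two parts. *)
Lemma tent_sums_le a N T y : 4 <= T -> 1 <= y ->
  T ^+ 2 * (tent_sum (@complex.Re R \o a) N T (ln y) ^+ 2 +
            tent_sum (@complex.Im R \o a) N T (ln y) ^+ 2) <=
  2 * T ^+ 2 * cabs (cesaro_sum a N T y) ^+ 2 +
  256 * window_sum a N (y / (T - 1)) y ^+ 2.
Proof.
move=> T4 y1; rewrite cabs_cesaro_sum; have T0 : 0 < T by lra.
have H1 := @tent_sum_le a (@complex.Re R \o a) N T y T4 y1 (fun n => normRe_le_cabs (a n)).
have H2 := @tent_sum_le a (@complex.Im R \o a) N T y T4 y1 (fun n => normIm_le_cabs (a n)).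
have := ler_wpM2l (sqr_ge0 T) (lerD H1 H2); move/le_trans; apply.
rewrite le_eqVlt; apply/orP; left; apply/eqP; field; by rewrite gt_eqF.
Qed.


(** * Measurability of the two integrands *)

Let itv1 : set (measurableTypeR R) := `[1%R, +oo[.

Lemma measurable_inv_itv1 : measurable_fun itv1 (fun y : R => y^-1).
Proof.
have : measurable_fun (`]0%R, +oo[ : set (measurableTypeR R)) (fun y : R => y^-1).
  apply: open_continuous_measurable_fun; first exact: interval_open.
  by move=> y; rewrite inE/= in_itv/= andbT => y0; apply: inv_continuous; rewrite gt_eqF.
apply: measurable_funS => //.
by move=> y; rewrite /itv1/= !in_itv/= !andbT; apply: lt_le_trans.
Qed.

Lemma measurable_cesaro_sqr a N T :
  measurable_fun itv1 (fun y => (cabs (cesaro_sum a N T y) ^+ 2 / y)%:E).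
Proof.
apply/measurable_EFinP; apply: measurable_funM; last exact: measurable_inv_itv1.
rewrite (_ : (fun _ => _) = fun y => weighted_sum (@complex.Re R \o a) N T y ^+ 2 +
   weighted_sum (@complex.Im R \o a) N T y ^+ 2); last first.
  by apply/funext => y; rewrite cabs_cesaro_sum.
have mw b : measurable_fun itv1 (weighted_sum b N T).
  apply: measurable_sum => n; apply: measurable_funM; last exact: measurable_cst.
  apply: measurable_maxr; last exact: measurable_cst.
  apply: measurable_funB; first exact: measurable_cst.
  apply: measurable_funM.
    rewrite (_ : (fun _ => _) = fun y : R => y^-1 * T).
      by apply: measurable_funM; [exact: measurable_inv_itv1|exact: measurable_cst].
    by apply/funext => y; rewrite invfM invrK.
  by apply: measurableT_comp => //; apply: measurable_funB.
by apply: measurable_funD; apply: measurable_funX.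
Qed.

Lemma measurable_window_sqr a N c :
  measurable_fun itv1 (fun y => (window_sum a N (y / c) y ^+ 2 / y)%:E).
Proof.
apply/measurable_EFinP; apply: measurable_funM; last exact: measurable_inv_itv1.
apply: measurable_funX.
(* Moving the y-dependent index condition into the terms gives a sum over a fixed range. *)
rewrite (_ : (fun _ => _) = fun y => \sum_(1 <= n < N.+1)
    (if y - y / c <= n%:R <= y + y / c then cabs (a n) else 0)); last first.
  by apply/funext => y; rewrite /window_sum big_mkcond.
have mc : measurable_fun setT (fun y : measurableTypeR R => y / c).
  by apply: measurable_funM => //; exact: measurable_cst.
apply: measurable_sum => n; apply: measurable_funTS; apply: measurable_fun_ifT => //.
apply: measurable_and; apply: measurable_fun_ler => //.
- exact: measurable_funB.
- exact: measurable_funD.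
Qed.

End Comparison.

(** * Assembling the mean square inequality *)

Section Main.
Variable R : realType.
Implicit Types (a : nat -> R[i]) (b : nat -> R) (c x u v w T X t y : R) (N n : nat).

Lemma EFin_Rintegral (f : R -> R) c x :
  lebesgue_measure.-integrable `[c, x] (EFin \o f) ->
  (\int[lebesgue_measure]_(y in `[c, x]) (f y)%:E)%E =
  (\int[lebesgue_measure]_(y in `[c, x]) f y)%:E.
Proof. by move=> fi; rewrite /Rintegral fineK//; exact: integrable_fin_num. Qed.

Lemma RintegralD_itv (f g : R -> R) c x : cts f -> cts g ->
  \int[lebesgue_measure]_(y in `[c, x]) (f y + g y) =
  \int[lebesgue_measure]_(y in `[c, x]) f y + \int[lebesgue_measure]_(y in `[c, x]) g y.
Proof. by move=> cf cg; apply: RintegralD => //; exact: continuous_integrable_itv. Qed.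

(** The constant of [energy_le_tent_sum], doubled by folding u < 0 onto u > 0. *)
Definition energy_const : R := 4 * pi * (cos 1 / 2) ^- 2.

Lemma energy_const_gt0 : 0 < energy_const.
Proof. by rewrite !mulr_gt0 ?pi_gt0 ?invr_gt0 ?exprn_gt0// divr_gt0// cos1_gt0. Qed.

(** [X] is chosen before [b], so one value serves both the real and the imaginary parts. *)
Lemma energy_le_half N T : 4 <= T -> exists2 X, 0 <= X & forall b,
  \int[lebesgue_measure]_(t in `[- T, T]) energy b N t <=
  energy_const * T ^+ 2 * \int[lebesgue_measure]_(u in `[0, X]) tent_sum b N T u ^+ 2.
Proof.
move=> T4; have T0 : 0 < T by lra.
(* Any M > B satisfies pi M - T ln n >= 1 for all n <= N, because pi >= 1. *)
set B := T * ln N.+1%:R + 1.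
have l0 : 0 <= ln N.+1%:R :> R by rewrite ln_ge0// ler1n.
have B0 : 0 <= B by rewrite addr_ge0// mulr_ge0// ltW.
have BM := archi_boundP B0; set M := Num.bound B in BM.
have pi2 := pi_ge2 R.
have M0 : (0 < M)%N by rewrite -(ltr0n R); apply: le_lt_trans BM.
exists (pi * M%:R / T); first by rewrite divr_ge0 ?mulr_ge0//; lra.
move=> b; apply: le_trans (energy_le_tent_sum b T0 M0 _) _; last first.
  rewrite (_ : energy_const * T ^+ 2 = 2 * pi * (cos 1 / 2) ^- 2 * T ^+ 2 * 2); last first.
    by rewrite /energy_const; ring.
  rewrite -[leRHS]mulrA ler_wpM2l//.
    by rewrite !mulr_ge0 ?invr_ge0 ?sqr_ge0//; lra.
  rewrite tent_sum_half// divr_ge0 ?mulr_ge0//; lra.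
move=> n /andP[n0 nN].
have -> : T * (pi * M%:R / T - ln n%:R) = pi * M%:R - T * ln n%:R.
  by field; rewrite gt_eqF.
have : T * ln n%:R <= T * ln N.+1%:R.
  by rewrite ler_pM2l// ler_ln ?posrE ?ltr0n ?ler_nat// ltnW.
have : M%:R <= pi * M%:R :> R by rewrite ler_peMl//; lra.
rewrite /B in BM; lra.
Qed.

Lemma mean_square_le a N T : 4 <= T ->
  (\int[lebesgue_measure]_(t in `[(- T)%R, T]) (cabs (dirichlet_poly a N t) ^+ 2)%:E <=
   (512 * energy_const)%:E *
    ((T ^+ 2)%:E * \int[lebesgue_measure]_(y in `[1%R, +oo[)
                     (cabs (cesaro_sum a N T y) ^+ 2 / y)%:E
     + \int[lebesgue_measure]_(y in `[1%R, +oo[)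
         (window_sum a N (y / (T - 1)) y ^+ 2 / y)%:E))%E.
Proof.
move=> T4; have T0 : 0 < T by lra.
have [X X0 HX] := energy_le_half N T4.
set A := (\int[lebesgue_measure]_(y in _) (cabs _ ^+ 2 / y)%:E)%E.
set B := (\int[lebesgue_measure]_(y in _) (window_sum _ _ _ _ ^+ 2 / y)%:E)%E.
have sqr_div_ge0 (r y : R) : `[1%R, +oo[%classic y -> (0 <= (r ^+ 2 / y)%:E)%E.
  rewrite /= in_itv/= andbT => y1; rewrite lee_fin divr_ge0 ?sqr_ge0//.
  exact: le_trans y1.
have A0 : (0 <= A)%E by apply: integral_ge0 => y; exact: sqr_div_ge0.
have B0 : (0 <= B)%E by apply: integral_ge0 => y; exact: sqr_div_ge0.
have T20 : 0 <= 2 * T ^+ 2 by rewrite mulr_ge0// sqr_ge0.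
pose re := @complex.Re R \o a; pose im := @complex.Im R \o a.
have cr := @cts_tent_sum R re N T; have ci := @cts_tent_sum R im N T.
pose f u := T ^+ 2 * (tent_sum re N T u ^+ 2 + tent_sum im N T u ^+ 2).
have cf : cts f by rewrite /f; cts_tac.
set J := \int[lebesgue_measure]_(u in `[0, X]) f u.
have cer := @cts_energy R re N; have cei := @cts_energy R im N.
have step1 : (\int[lebesgue_measure]_(t in `[(- T)%R, T]) (cabs (dirichlet_poly a N t) ^+ 2)%:E <=
    (2 * energy_const * J)%:E)%E.
  have c1 : cts (fun t => 2 * (energy re N t + energy im N t)) by cts_tac.
  have i1 := continuous_integrable_itv (- T) T c1.
  have i2 := continuous_integrable_itv (- T) T (@cts_cabs_dirichlet_poly _ a N).
  rewrite EFin_Rintegral// lee_fin.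
  apply: (@le_trans _ _ (\int[lebesgue_measure]_(t in `[- T, T])
     (2 * (energy re N t + energy im N t)))).
    by apply: le_Rintegral => // t _; exact: cabs_dirichlet_poly_le.
  rewrite RintegralZl//; last by apply: continuous_integrable_itv; cont.
  rewrite (@RintegralD_itv (energy re N) (energy im N))//.
  rewrite /J RintegralZl//; last by apply: continuous_integrable_itv; cont.
  rewrite (@RintegralD_itv (fun u => tent_sum re N T u ^+ 2)
    (fun u => tent_sum im N T u ^+ 2)); [|by cts_tac..].
  apply: le_trans (ler_wpM2l (ler0n R 2) (lerD (HX re) (HX im))) _.
  by rewrite -mulrDr !mulrA.
apply: le_trans step1 _.
have [JE gi] := Rintegral_expR X0 cf; rewrite -/J in JE.
set g := fun y => _ in gi.
(* The pointwise majorant given by [tent_sums_le], divided by y. *)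
pose h y : \bar R := ((2 * T ^+ 2)%:E * (cabs (cesaro_sum a N T y) ^+ 2 / y)%:E
   + 256%:E * (window_sum a N (y / (T - 1)) y ^+ 2 / y)%:E)%E.
have mc := @measurable_cesaro_sqr _ a N T; have mw := @measurable_window_sqr _ a N (T - 1).
have mh : measurable_fun (`[1%R, +oo[ : set (measurableTypeR R)) h.
  by apply: emeasurable_funD; apply: emeasurable_funM => //; exact: measurable_cst.
have h1 y : `[1%R, +oo[%classic y ->
    (0 <= (2 * T ^+ 2)%:E * (cabs (cesaro_sum a N T y) ^+ 2 / y)%:E)%E.
  by move=> y1; rewrite mule_ge0 ?sqr_div_ge0// lee_fin.
have h2 y : `[1%R, +oo[%classic y ->
    (0 <= 256%:E * (window_sum a N (y / (T - 1)) y ^+ 2 / y)%:E)%E.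
  by move=> y1; apply: mule_ge0; [rewrite lee_fin ler0n|exact: sqr_div_ge0].
have h0 y : `[1%R, +oo[%classic y -> (0 <= h y)%E.
  by move=> y1; rewrite adde_ge0 ?h1 ?h2.
(* After y = exp u the range is [1, exp X]; since h >= 0 it may be enlarged to the whole half-line,
   removing the dependence on X. *)
have step2 : (J%:E <= (2 * T ^+ 2)%:E * A + 256%:E * B)%E.
  rewrite JE -EFin_Rintegral//.
  apply: (@le_trans _ _ (\int[lebesgue_measure]_(y in `[1%R, expR X]) h y)%E).
    apply: ge0_le_integral => //.
    - move=> y _; rewrite lee_fin divr_ge0//.
        by rewrite mulr_ge0 ?addr_ge0 ?sqr_ge0.
      by rewrite le_max ler01 orbT.
    - exact: (measurable_int lebesgue_measure gi).
    - apply: measurable_funS mh => //; exact: subset_itvl.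
    - move=> y; rewrite /= in_itv/= => /andP[y1 _].
      rewrite /h -!EFinM -EFinD lee_fin max_l//
        [_ * (cabs _ ^+ 2 / y)]mulrA [_ * (window_sum _ _ _ _ ^+ 2 / y)]mulrA.
      rewrite -mulrDl ler_wpM2r//.
        by rewrite invr_ge0; lra.
      exact: tent_sums_le.
  apply: (@le_trans _ _ (\int[lebesgue_measure]_(y in `[1%R, +oo[) h y)%E).
    by apply: ge0_subset_integral => //; exact: subset_itvl.
  rewrite /h ge0_integralD//; first last.
  - by apply: emeasurable_funM => //; exact: measurable_cst.
  - by apply: emeasurable_funM => //; exact: measurable_cst.
  by rewrite !ge0_integralZl_EFin ?ler0n// => y; exact: sqr_div_ge0.
have K0 : 0 <= 2 * energy_const by rewrite mulr_ge0// ltW// energy_const_gt0.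
(* 512 = 2 * 256: 2 comes from splitting D into two parts, and 256 is the larger of the weights 2
   and 256 of [step2]. *)
rewrite EFinM (_ : 512 * energy_const = 2 * energy_const * 256); last by ring.
rewrite (EFinM _ 256) -muleA; apply: lee_wpmul2l; first by rewrite lee_fin.
apply: le_trans step2 _.
have TA : (0 <= (T ^+ 2)%:E * A)%E by rewrite mule_ge0// lee_fin sqr_ge0.
rewrite (ge0_muleDr _ TA B0); apply: leeD => //.
by rewrite EFinM -muleA; apply: lee_wpmul2r => //; rewrite lee_fin ler_nat.
Qed.

End Main.

Theorem theorem1 (R : realType) :
  exists (Delta : R -> R -> R) (K T0 c : R),
    [/\ 0 < T0, 0 < c,
        (forall y T : R, 1 <= y -> T0 <= T ->
           `|Delta y T - y / T| <= K * (y / T ^+ 2)) &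
        (forall (a : nat -> R[i]) (N : nat) (T : R), T0 <= T ->
           (norm2T (dirichlet_poly a N) T ^+ 2 <=
            c%:E *
            ((T ^+ 2)%:E *
               \int[lebesgue_measure]_(y in `[1%R, +oo[)
                  (cabs (cesaro_sum a N T y) ^+ 2 / y)%:E
             + \int[lebesgue_measure]_(y in `[1%R, +oo[)
                  (window_sum a N (Delta y T) y ^+ 2 / y)%:E))%E)].
Proof.
(* y/(T - 1) is the radius beyond which both weights vanish. It differs from y/T by (y/T^2) T/(T -
   1), and T/(T - 1) <= 2, whence K = 2. *)
exists (fun y T => y / (T - 1)), 2, 4, (512 * energy_const R); split.
- by rewrite ltr0n.
- by rewrite mulr_gt0 ?energy_const_gt0 ?ltr0n.
- move=> y T y1 T4.
  have -> : y / (T - 1) - y / T = y / T ^+ 2 * (T / (T - 1)).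
    by field; rewrite !gt_eqF; lra.
  have T1 : 0 < T - 1 by lra.
  have q0 : 0 <= y / T ^+ 2 by rewrite divr_ge0 ?sqr_ge0; lra.
  rewrite ger0_norm; last by rewrite mulr_ge0// divr_ge0; lra.
  by rewrite mulrC ler_wpM2r// ler_pdivrMr//; lra.
- move=> a N T T4; rewrite /norm2T.
  have I0 : (0 <= \int[lebesgue_measure]_(t in `[(- T)%R, T])
      (cabs (dirichlet_poly a N t) ^+ 2)%:E)%E.
    by apply: integral_ge0 => t _; rewrite lee_fin sqr_ge0.
  by rewrite poweR12_sqrt// sqr_sqrte//; exact: mean_square_le.
Qed.
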